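(* Let $\mathcal{A}$ be an algebra with two multiplications $\cdot$ and $\ast$, with cumulants $\kappa$ and $\kappa^\ast$ as in the context. Let $A_1,\dots,A_n$ be finite multisets of elements of $\mathcal{A}$, $A_i=\{a^i_1,\dots,a^i_{k_i}\}$, and $A=A_1\cup\cdots\cup A_n$. Then $$\kappa^\ast\!\left(a^1_1\ast\cdots\ast a^1_{k_1},\ \dots,\ a^n_1\ast\cdots\ast a^n_{k_n}\right)=\sum_{F\in\overline{\overline{\mathcal{F}}}(A)}(-1)^{w_F}\,\kappa_F ,$$ where $\overline{\overline{\mathcal{F}}}(A)$ is the set of strongly-mixing reduced forests with leaves in $A$.
   Context: An algebra with two multiplications is a vector space $\mathcal{A}$ over a field with two bilinear products $\cdot$ and $\ast$ such that $(\mathcal{A},\cdot)$ and $(\mathcal{A},\ast)$ are both commutative associative unital algebras. The cumulants $\kappa:\mathcal{A}^m\to\mathcal{A}$ ($m\ge1$) are the symmetric multilinear maps determined by $a_1\ast\cdots\ast a_m=\sum_{\nu}\prod_{b\in\nu}\kappa(a_i:i\in b)$ (sum over set partitions $\nu$ of $\{1,\dots,m\}$, product being the $\cdot$-product); the cumulants $\kappa^\ast$ are the symmetric multilinear maps determined by $a_1\cdot\cdots\cdot a_m=\sum_{\nu}\mathop{\ast}_{b\in\nu}\kappa^\ast(a_i:i\in b)$ (product over blocks being the $\ast$-product). The elements $a^i_j$ of $A$ are regarded as distinguishable; $a^i_j$ belongs to $A_i$. A reduced forest with leaves in $A$ is a finite forest of rooted trees with unordered children whose leaves (vertices with no children; a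 one-vertex tree is a single leaf) are labelled bijectively by the elements of $A$ and in which every non-leaf vertex has at least two children, taken up to label-preserving isomorphism. Define $\kappa_v=a_v$ (label) for a leaf and $\kappa_v=\kappa(\kappa_{v_1},\dots,\kappa_{v_m})$ for a vertex with children $v_1,\dots,v_m$; $\kappa_F$ is the $\ast$-product of $\kappa_V$ over all roots $V$. $F$ is mixing if for every vertex all of whose children are leaves, those children belong to at least two distinct multisets $A_i\ne A_j$; then $w_F$ = (number of vertices) $-$ (number of leaves). A row partition of $A$ is a partition $\{\lambda_1,\lambda_2\}$ of $A$ into two nonempty blocks such that each $A_i$ is contained in $\lambda_1$ or in $\lambda_2$. A partition $\nu$ of $A$ is strongly-mixing if there is no row partition $\{\lambda_1,\lambda_2\}$ such that every block of $\nu$ is contained in $\lambda_1$ or in $\lambda_2$. A mixing reduced forest $F$ with trees $T_1,\dots,T_s$ is strongly-mixing if the partition $\nu_F=\{\{\text{labels of leaves of }T_k\}:k\in[s]\}$ of $A$ is strongly-mixing. *)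

(* Defs.v *)
From HB Require Import structures.
From mathcomp Require Import all_boot all_order all_algebra.

Set Implicit Arguments.
Unset Strict Implicit.
Unset Printing Implicit Defensive.

Import GRing.Theory.
Local Open Scope ring_scope.

(* The two products are not required to have the same unit.  Bilinearity is
   linearity on the right together with commutativity. *)
HB.mixin Record hasTwoMultiplications (K : fieldType) A
    of GRing.Lmodule K A := {
  dot : A -> A -> A;
  dot1 : A;
  star : A -> A -> A;
  star1 : A;
  dotA : associative dot;
  dotC : commutative dot;
  dot1x : left_id dot1 dot;
  dot_linear : forall x : A, linear (dot x);
  starA : associative star;
  starC : commutative star;
  star1x : left_id star1 star;
  star_linear : forall x : A, linear (star x)
}.

#[short(type="twoMulAlgType")]
HB.structure Definition TwoMulAlgebra (K : fieldType) :=
  {A of hasTwoMultiplications K A & GRing.Lmodule K A}.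

Arguments dot1 {K s}.
Arguments star1 {K s}.

HB.instance Definition _ (K : fieldType) (A : twoMulAlgType K) :=
  Monoid.isComLaw.Build A dot1 (@dot K A) (@dotA K A) (@dotC K A) (@dot1x K A).
HB.instance Definition _ (K : fieldType) (A : twoMulAlgType K) :=
  Monoid.isComLaw.Build A star1 (@star K A)
    (@starA K A) (@starC K A) (@star1x K A).

Section Cumulants.
Variables (K : fieldType) (A : twoMulAlgType K).

(* A family of maps A^m -> A, m >= 1, is a function on sequences; its value
   at the empty sequence is irrelevant. *)
Definition symmetric_family (kappa : seq A -> A) : Prop :=
  forall s t : seq A, perm_eq s t -> kappa s = kappa t.

Definition multilinear_family (kappa : seq A -> A) : Prop :=
  forall s t : seq A, linear (fun x => kappa (s ++ x :: t)).

Definition is_kappa (kappa : seq A -> A) : Prop :=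
  [/\ symmetric_family kappa, multilinear_family kappa &
      forall (m : nat) (a : 'I_m -> A), (0 < m)%N ->
        \big[star/star1]_(i < m) a i =
        \sum_(nu : {set {set 'I_m}} | partition nu [set: 'I_m])
          \big[dot/dot1]_(b in nu) kappa [seq a i | i <- enum b]].

Definition is_kappa_star (kappa : seq A -> A) : Prop :=
  [/\ symmetric_family kappa, multilinear_family kappa &
      forall (m : nat) (a : 'I_m -> A), (0 < m)%N ->
        \big[dot/dot1]_(i < m) a i =
        \sum_(nu : {set {set 'I_m}} | partition nu [set: 'I_m])
          \big[star/star1]_(b in nu) kappa [seq a i | i <- enum b]].

End Cumulants.

(* Isomorphism classes of rooted trees of height at most d with unordered
   children and leaves labelled in L: such a tree is a leaf or the set of the
   subtrees at the children of its root.  Taking a set of children is harmless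
   because distinct subtrees of a tree with bijectively labelled leaves carry
   disjoint nonempty sets of labels, hence are not isomorphic.  The childless
   unlabelled vertex [inr set0] is excluded by [reduced]. *)
Fixpoint utree (L : finType) (d : nat) : finType :=
  if d is d'.+1 then (L + {set utree L d'})%type : finType else L.

Section Trees.
Variable L : finType.

Definition leaf (d : nat) : L -> utree L d :=
  match d return L -> utree L d with
  | 0 => fun x => x
  | d'.+1 => fun x => inl x
  end.

Fixpoint leaf_labels (d : nat) : utree L d -> seq L :=
  match d return utree L d -> seq L with
  | 0 => fun x => [:: x]
  | d'.+1 => fun t =>
      match t with
      | inl x => [:: x]
      | inr C => flatten [seq leaf_labels c | c <- enum C]
      end
  end.

Fixpoint nb_vertices (d : nat) : utree L d -> nat :=
  match d return utree L d -> nat with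
  | 0 => fun _ => 1%N
  | d'.+1 => fun t =>
      match t with
      | inl _ => 1%N
      | inr C => (1 + \sum_(c in C) nb_vertices c)%N
      end
  end.

Fixpoint reduced (d : nat) : utree L d -> bool :=
  match d return utree L d -> bool with
  | 0 => fun _ => true
  | d'.+1 => fun t =>
      match t with
      | inl _ => true
      | inr C => (1 < #|C|)%N && [forall c in C, reduced c]
      end
  end.

(* [row x] is the index i of the multiset A_i to which the label x belongs. *)
Fixpoint mixing (I : eqType) (row : L -> I) (d : nat) : utree L d -> bool :=
  match d return utree L d -> bool with
  | 0 => fun _ => true
  | d'.+1 => fun t =>
      match t with
      | inl _ => true
      | inr C =>
          ([forall c in C, [exists x, c == leaf d' x]] ==>
           [exists x, exists y,
              [&& leaf d' x \in C, leaf d' y \in C & row x != row y]])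
          && [forall c in C, mixing row c]
      end
  end.

Fixpoint kappa_tree (V : Type) (kappa : seq V -> V) (a : L -> V) (d : nat) :
    utree L d -> V :=
  match d return utree L d -> V with
  | 0 => fun x => a x
  | d'.+1 => fun t =>
      match t with
      | inl x => a x
      | inr C => kappa [seq kappa_tree kappa a c | c <- enum C]
      end
  end.

(* A reduced tree with distinctly labelled leaves has height less than its
   number of leaves, so the height bound #|L| excludes nothing; a forest is a
   set of trees since its trees too have disjoint sets of labels. *)
Definition forest : finType := {set utree L #|L|}.

Definition forest_labels (F : forest) : seq L :=
  flatten [seq leaf_labels t | t <- enum F].

Definition reduced_forest (F : forest) : bool :=
  perm_eq (forest_labels F) (enum L) && [forall t in F, reduced t].

Definition mixing_forest (I : eqType) (row : L -> I) (F : forest) : bool :=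
  [forall t in F, mixing row t].

Definition weight (F : forest) : nat :=
  (\sum_(t in F) nb_vertices t - size (forest_labels F))%N.

Definition forest_partition (F : forest) : {set {set L}} :=
  [set [set x in leaf_labels t] | t in F].

Definition row_partition (I : finType) (row : L -> I)
    (lambda : {set {set L}}) : bool :=
  [&& partition lambda [set: L], #|lambda| == 2 &
      [forall i, [exists l in lambda, [set x | row x == i] \subset l]]].

Definition strongly_mixing_partition (I : finType) (row : L -> I)
    (nu : {set {set L}}) : bool :=
  ~~ [exists lambda : {set {set L}}, row_partition row lambda &&
        [forall b in nu, [exists l in lambda, b \subset l]]].

Definition strongly_mixing_reduced_forest (I : finType) (row : L -> I)
    (F : forest) : bool :=
  [&& reduced_forest F, mixing_forest row F &
      strongly_mixing_partition row (forest_partition F)].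

Definition kappa_forest (K : fieldType) (A : twoMulAlgType K)
    (kappa : seq A -> A) (a : L -> A) (F : forest) : A :=
  \big[star/star1]_(t in F) kappa_tree kappa a t.

End Trees.

(* Main.v *)
Require Import Defs.
From HB Require Import structures.
From mathcomp Require Import all_boot all_order all_algebra.

Set Implicit Arguments.
Unset Strict Implicit.
Unset Printing Implicit Defensive.

Import GRing.Theory.
Local Open Scope ring_scope.

(* For a set S of labels let T(S) be the signed sum of the values of the mixing
   reduced trees with label set S.  Decomposing a tree at its root gives
   T({x}) = a_x and, for |S| > 1,
     T(S) = - sum_pi kappa(T(b) : b in pi),
   over the partitions pi of S with at least two blocks, the partition into
   singletons being excluded if S lies in one row.  Equivalently,
     sum_{pi partition of S} kappa(T(b) : b in pi)
   is kappa(a_x : x in S) if S lies in one row, and 0 otherwise.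
   Writing the star-products with cumulants, sum_nu star_{b in nu} T(b) becomes
   a sum over partitions of a partition, which by this identity collapses to
   the sum over the partitions with each block in one row of the dot-products
   of the kappa(a_x : x in b), i.e. to the dot-product of the star-products of
   the rows.
   Finally, every partition nu splits uniquely into connected (strongly mixing)
   components lying over the blocks of a partition of the set of rows, so the
   sums of star_{b in nu} T(b) over connected nu satisfy the recursion that
   determines kappa_star. *)

(** * Partitions and multilinear expansion *)

Section Partitions.
Variable T : finType.
Implicit Types (D : {set T}) (P : {set {set T}}).

(** The elementwise form in which partitions are built and used below: containment, covering,
    disjointness and nonemptiness of blocks. *)
Lemma partition_pointwiseP P D :
  reflect [/\ forall B x, B \in P -> x \in B -> x \in D,
              forall x, x \in D -> exists2 B, B \in P & x \in B,
              forall B C x, B \in P -> C \in P -> x \in B -> x \in C -> B = C &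
              forall B, B \in P -> exists x, x \in B]
          (partition P D).
Proof.
apply: (iffP and3P) => [[/eqP covP tiP n0]|[sub cov ti ne]].
  split=> [B x BP xB|x|B C x BP CP xB xC|B BP].
  - by rewrite -covP; apply/bigcupP; exists B.
  - by rewrite -covP => /bigcupP[B BP xB]; exists B.
  - by rewrite -(def_pblock tiP BP xB) (def_pblock tiP CP xC).
  - by apply/set0Pn; apply: contraNneq n0 => <-.
split.
- apply/eqP/setP => x; apply/bigcupP/idP => [[B BP xB]|/cov[B BP xB]].
    exact: sub BP xB.
  by exists B.
- apply/trivIsetP => B C BP CP; apply: contraR => /pred0Pn[x /andP[xB xC]].
  by apply/eqP; apply: ti xB xC.
- by apply/negP => /ne[x]; rewrite inE.
Qed.

Lemma partition_set1 D : D != set0 -> partition [set D] D.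
Proof.
move=> D0; rewrite /partition cover1 eqxx trivIset1 /= inE eq_sym.
exact: D0.
Qed.

(** Singles out the one-block partition, the term that is isolated in both recursions, over trees
    and over sets of rows. *)
Lemma partition_card_le1 P D :
  D != set0 -> partition P D -> (#|P| <= 1)%N = (P == [set D]).
Proof.
move=> D0 PD; apply/idP/eqP => [|->]; last by rewrite cards1.
rewrite leq_eqVlt ltnS leqn0 => /orP[/cards1P[B PB]|].
  by rewrite PB -(cover_partition PD) PB cover1.
by rewrite cards_eq0 => /eqP P0; move: PD D0; rewrite P0 => /cover_partition <-;
  rewrite /cover big_set0 eqxx.
Qed.

Lemma partition_singletons D : partition [set [set x] | x in D] D.
Proof.
apply/partition_pointwiseP; split.
- by move=> _ x /imsetP[y yD ->] /set1P->.
- by move=> x xD; exists [set x]; rewrite ?set11 // imset_f.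
- by move=> _ _ x /imsetP[y yD ->] /imsetP[z zD ->] /set1P<- /set1P<-.
- by move=> _ /imsetP[y yD ->]; exists y; rewrite set11.
Qed.

Lemma partition_in_singletons P D :
    partition P D -> (forall B, B \in P -> #|B| == 1%N) ->
  P = [set [set x] | x in D].
Proof.
move=> /partition_pointwiseP[sub cov ti ne] P1; apply/setP => B.
apply/idP/imsetP => [BP|[x xD ->]].
  have /cards1P[x Bx] := P1 _ BP.
  by exists x => //; apply: (sub _ _ BP); rewrite Bx set11.
have [B' BP xB] := cov _ xD.
by have /cards1P[y By] := P1 _ BP; move: xB BP; rewrite By => /set1P->.
Qed.

(** Makes the inductions on cardinality work: a block equal to [D] would leave no room for a second
    nonempty block. *)
Lemma partition_block_card P D B :
  partition P D -> (1 < #|P|)%N -> B \in P -> (#|B| < #|D|)%N.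
Proof.
move=> PD cP BP; apply: proper_card; rewrite properEneq (partitionS PD BP) andbT.
apply: contraTneq cP => BD; rewrite -leqNgt.
apply/card_le1_eqP => C C' CP C'P.
have [sub _ ti ne] := partition_pointwiseP _ _ PD.
suff eqB E : E \in P -> E = B by rewrite (eqB _ CP) (eqB _ C'P).
move=> EP; have [x xE] := ne _ EP; apply: (ti _ _ x) => //.
by rewrite BD; apply: sub EP xE.
Qed.

End Partitions.

(* A partition of a partition is the same as a choice, for each block of the
   coarser partition of [D], of a partition of this block. *)
Lemma nested_partitionE (T : finType) (Q : {set {set {set T}}}) (D : {set T}) :
  partition (cover Q) D && partition Q (cover Q) =
  [&& [forall c in Q, partition c (cover c)], dinjectiveb cover Q
    & partition (cover @: Q) D].
Proof.
apply/andP/and3P => [[PD QP]|[/forall_inP Pc /dinjectiveP inj QD]].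
  have [-> inj] := partition_partition PD QP; split=> //; last exact/dinjectiveP.
  apply/forall_inP => c cQ; rewrite /partition eqxx /=.
  have sub : c \subset cover Q by apply: (bigcup_max c).
  rewrite (trivIsetS sub (partition_trivIset PD)) /=.
  by apply: contra (subsetP sub set0) _; rewrite (partition0 PD).
have [sub cov ti ne] := partition_pointwiseP _ _ QD.
have inc c B x : c \in Q -> B \in c -> x \in B -> x \in cover c.
  by move=> cQ Bc xB; apply/bigcupP; exists B.
have eqc c c' B B' x :
    c \in Q -> c' \in Q -> B \in c -> B' \in c' -> x \in B -> x \in B' -> c = c'.
  move=> cQ c'Q Bc B'c' xB xB'; apply: inj => //.
  by apply: (ti _ _ x); rewrite ?imset_f ?(inc c B) ?(inc c' B').
have neB c B : c \in Q -> B \in c -> exists x, x \in B.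
  by move=> cQ Bc; have [_ _ _] := partition_pointwiseP _ _ (Pc _ cQ); apply.
split; apply/partition_pointwiseP; split.
- move=> B x /bigcupP[c cQ Bc] xB.
  by apply: (sub (cover c)); rewrite ?imset_f ?(inc c B).
- move=> x /cov[_ /imsetP[c cQ ->] /bigcupP[B Bc xB]]; exists B => //.
  by apply/bigcupP; exists c.
- move=> B B' x /bigcupP[c cQ Bc] /bigcupP[c' c'Q B'c'] xB xB'.
  have cc' := eqc _ _ _ _ _ cQ c'Q Bc B'c' xB xB'; subst c'.
  by have [_ _ tic _] := partition_pointwiseP _ _ (Pc _ cQ); apply: tic xB xB'.
- by move=> B /bigcupP[c cQ Bc]; apply: neB cQ Bc.
- by move=> c B cQ Bc; apply/bigcupP; exists c.
- by move=> B /bigcupP[c cQ Bc]; exists c.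
- move=> c c' B cQ c'Q Bc Bc'; have [x xB] := neB _ _ cQ Bc.
  by apply: (eqc c c' B B x).
- move=> c cQ; have [x] := ne _ (imset_f cover cQ).
  by case/bigcupP=> B Bc _; exists B.
Qed.

Lemma partition_card_le (T : finType) (P : {set {set T}}) (D : {set T}) :
  partition P D -> (#|D| <= 1)%N -> (#|P| <= 1)%N.
Proof.
move=> PD D1; rewrite leqNgt; apply/negP => P1.
have /card_gt0P[B BP] : (0 < #|P|)%N by apply: ltnW.
have := leq_trans (partition_block_card PD P1 BP) D1.
by rewrite ltnS leqn0 cards_eq0 (negPf (partition_neq0 PD BP)).
Qed.

Lemma perm_map_enum (X Y : finType) (f : X -> Y) (F : {set X}) (G : {set Y}) :
  perm_eq [seq f x | x <- enum F] (enum G) = dinjectiveb f F && (f @: F == G).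
Proof.
rewrite /dinjectiveb; apply/idP/andP => [pe|[u /eqP eG]].
  rewrite (perm_uniq pe) enum_uniq; split=> //; apply/eqP/setP => y.
  rewrite -[RHS]mem_enum -(perm_mem pe).
  by apply/imsetP/mapP => -[x xF ->]; exists x; rewrite ?mem_enum in xF *.
apply: uniq_perm => // [|y]; first exact: enum_uniq.
rewrite mem_enum -eG.
by apply/mapP/imsetP => -[x xF ->]; exists x; rewrite ?mem_enum in xF *.
Qed.

Section Multilinear.
Variables (K : fieldType) (A : twoMulAlgType K) (M : seq A -> A).
Hypotheses (symM : symmetric_family M) (linM : multilinear_family M).

Lemma multilinear_sum (I : Type) (r : seq I) (P : pred I) (f : I -> A) s t :
  M (s ++ \sum_(i <- r | P i) f i :: t) = \sum_(i <- r | P i) M (s ++ f i :: t).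
Proof.
apply: (big_morph (fun x => M (s ++ x :: t))) => [x y|].
  by have := linM s t 1 x y; rewrite !scale1r.
(* Linearity with coefficient -1 at the vectors 0 and 0 gives the value 0 at 0. *)
by have := linM s t (-1) 0 0; rewrite scaler0 addr0 scaleN1r addNr.
Qed.

Lemma multilinear_scale c x s t : M (s ++ c *: x :: t) = c *: M (s ++ x :: t).
Proof.
have := linM s t c x 0; rewrite addr0 => ->.
by have := multilinear_sum [::] xpred0 (fun _ : nat => 0) s t;
  rewrite !big_nil => ->; rewrite addr0.
Qed.

Lemma multilinear_scales (I : Type) (r : seq I) (c : I -> K) (f : I -> A) :
  M [seq c i *: f i | i <- r] = (\prod_(i <- r) c i) *: M [seq f i | i <- r].
Proof.
rewrite -[map _ r]/([::] ++ map _ r) -[[seq f i | i <- r]]/([::] ++ map _ r).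
elim: r [::] => [|i r IHr] s; first by rewrite big_nil scale1r.
by rewrite big_cons /= multilinear_scale -cat_rcons IHr cat_rcons scalerA.
Qed.

(* Expanding by multilinearity amounts to choosing, over each [y], an element
   of the fibre of [supp]; the choices are encoded by their sets of values. *)
Lemma multilinear_choice_seq (X : finType) (Y : eqType) (supp : X -> Y)
    (P : pred X) (f : X -> A) (r : seq Y) s :
    uniq r ->
  M (s ++ [seq \sum_(x | P x && (supp x == y)) f x | y <- r]) =
  \sum_(F : {set X} | [forall x in F, P x] &&
                      perm_eq [seq supp x | x <- enum F] r)
     M (s ++ [seq f x | x <- enum F]).
Proof.
elim: r s => [|y r IHr] s /=.
  move=> _; rewrite (big_pred1 set0) ?enum_set0 // => F /=.
  apply/andP/eqP => [[_ /perm_size]|->].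
    by rewrite size_map -cardE => /eqP; rewrite cards_eq0 => /eqP.
  by split; [apply/forall_inP => x; rewrite inE | rewrite enum_set0].
case/andP=> yr ur; rewrite multilinear_sum.
pose cond (F : {set X}) r := [forall x in F, P x] &&
                             perm_eq [seq supp x | x <- enum F] r.
transitivity (\sum_(x | P x && (supp x == y))
    \sum_(F | cond F (y :: r) && (x \in F)) M (s ++ [seq f x | x <- enum F])).
  apply: eq_bigr => x /andP[Px /eqP sx].
  (* Choices over [y :: r] that pick [x] correspond to choices over [r] by removing [x]; here [y]
     not in [r] ensures that [x] is not picked again. *)
  rewrite -cat_rcons IHr // [RHS](reindex_onto (fun F => x |: F) (fun F => F :\ x)).
    have eU (F : {set X}) : x \notin F -> perm_eq (enum (x |: F)) (x :: enum F).
      move=> xF; apply: uniq_perm; rewrite ?enum_uniq //= ?mem_enum ?xF ?enum_uniq //.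
      by move=> z; rewrite !(mem_enum, inE).
    have eC (F : {set X}) : (cond (x |: F) (y :: r) && (x \in x |: F)) &&
        ((x |: F) :\ x == F) = cond F r.
      rewrite setU11 andbT; apply/andP/andP => [[/andP[PF pe] /eqP xF]|[PF pe]].
        have nxF : x \notin F by rewrite -xF setD11.
        split.
          by apply/forall_inP => z zF; apply: (forall_inP PF); rewrite !inE zF orbT.
        rewrite -(perm_cons y) -(permPr pe) -sx -[supp x :: _]/(map supp (x :: enum F)).
        by rewrite perm_sym; apply: perm_map; apply: eU.
      have nxF : x \notin F.
        apply: contra yr => xF; rewrite -(perm_mem pe) -sx; apply: map_f.
        by rewrite mem_enum.
      rewrite setU1K //; split=> //; apply/andP; split.
        apply/forall_inP => z /setU1P[->//|]; exact: (forall_inP PF).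
      rewrite (permPl (perm_map supp (eU _ nxF))) /= sx perm_cons; exact: pe.
    apply/esym/eq_big => [F|F]; first exact: eC.
    rewrite [X in is_true X]eC => /andP[PF pe].
    have nxF : x \notin F.
      apply: contra yr => xF; rewrite -(perm_mem pe) -sx; apply: map_f.
      by rewrite mem_enum.
    by rewrite cat_rcons; apply/symM; rewrite perm_cat2l;
      apply: (perm_map f (eU _ nxF)).
  by move=> F /andP[_ xF]; rewrite setD1K.
(* After the exchange the inner sum has one term, since each choice [F] contains exactly one [x]
   over [y]. *)
rewrite (exchange_big_dep (fun F => cond F (y :: r))) /=; last by move=> x F _ /andP[].
apply: eq_bigr => F cF; have /andP[PF pe] := cF.
have /mapP[x xF sx] : y \in [seq supp x | x <- enum F].
  by rewrite (perm_mem pe) inE eqxx.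
have u : {in enum F &, injective supp}.
  have : uniq [seq supp x | x <- enum F] by rewrite (perm_uniq pe) /= yr ur.
  by move/dinjectiveP => inj z w; rewrite !mem_enum; apply: inj.
rewrite (big_pred1 x) // => z /=; rewrite cF /=.
rewrite mem_enum in xF.
apply/andP/eqP => [[/andP[_ /eqP sz] zF]|->]; last first.
  by rewrite sx eqxx xF (forall_inP PF).
by apply: u; rewrite ?mem_enum // sz sx.
Qed.

(** Summing over [G] as well frees the choice: [F] is any set of [P]-elements with distinct
    supports, and [G] is recovered as [supp @: F]. *)
Lemma multilinear_choice (X Y : finType) (supp : X -> Y) (P : pred X)
    (f : X -> A) (Q : pred {set Y}) :
  \sum_(G | Q G) M [seq \sum_(x | P x && (supp x == y)) f x | y <- enum G] =
  \sum_(F : {set X} | [&& [forall x in F, P x], dinjectiveb supp F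
                        & Q (supp @: F)])
     M [seq f x | x <- enum F].
Proof.
rewrite [RHS](partition_big (fun F : {set X} => supp @: F) Q) /=; last first.
  by move=> F /and3P[].
apply: eq_bigr => G QG.
rewrite -[LHS]/(M ([::] ++ _)) multilinear_choice_seq ?enum_uniq //.
apply: eq_bigl => F; rewrite perm_map_enum.
by case: eqP => [->|]; rewrite ?QG ?andbT ?andbF.
Qed.

End Multilinear.

(** * Cumulant expansions indexed by an arbitrary nonempty finite set *)

Section Cumulants.
Variables (A : nmodType) (o1 o2 : A).
Variables (op1 : Monoid.com_law o1) (op2 : Monoid.com_law o2).
Variable kappa : seq A -> A.
Hypothesis sym_kappa : forall s t : seq A, perm_eq s t -> kappa s = kappa t.
Hypothesis kappaE : forall (m : nat) (a : 'I_m -> A), (0 < m)%N ->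
  \big[op1/o1]_(i < m) a i =
  \sum_(nu : {set {set 'I_m}} | partition nu [set: 'I_m])
    \big[op2/o2]_(b in nu) kappa [seq a i | i <- enum b].

(** Transport of [kappaE] along the enumeration of [S]. The laws are abstract so that it serves both
    for [kappa] and for [kappa_star]. *)
Lemma cumulant_set (T : finType) (S : {set T}) (c : T -> A) : S != set0 ->
  \big[op1/o1]_(x in S) c x =
  \sum_(nu | partition nu S) \big[op2/o2]_(b in nu) kappa [seq c x | x <- enum b].
Proof.
rewrite -card_gt0 => S0; rewrite big_enum_val kappaE //.
pose ev : 'I_#|S| -> T := @enum_val T S.
have ev_inj : injective ev by exact: enum_val_inj.
pose h (nu : {set {set 'I_#|S|}}) := [set ev @: (b : {set 'I_#|S|}) | b in nu].
pose h' (mu : {set {set T}}) := [set ev @^-1: (b : {set T}) | b in mu].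
have evS : ev @: setT = S.
  apply/setP => x; apply/imsetP/idP => [[i _ ->]|xS]; first exact: enum_valP.
  by exists (enum_rank_in xS x) => //; rewrite /ev enum_rankK_in.
have evK (b : {set 'I_#|S|}) : ev @^-1: (ev @: b) = b.
  by apply/setP => i; rewrite inE mem_imset.
have ev'K (b : {set T}) : b \subset S -> ev @: (ev @^-1: b) = b.
  move=> /subsetP bS; apply/setP => x; apply/imsetP/idP => [[i + ->]|xb].
    by rewrite inE.
  exists (enum_rank_in (bS _ xb) x); last by rewrite /ev enum_rankK_in // bS.
  by rewrite inE /ev enum_rankK_in // bS.
rewrite [RHS](reindex_onto h h') => [|mu muS].
  apply: eq_big => nu.
    rewrite -(imset_partition nu _ ev_inj) evS /h' /h -imset_comp.
    rewrite (eq_imset _ (_ : _ =1 id)) ?imset_id ?eqxx ?andbT //.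
  move=> _; rewrite big_imset /=; last by move=> b b' _ _; apply: imset_inj.
  (* The image of a block may be enumerated in another order, which symmetry absorbs. *)
  apply: eq_bigr => b _; apply: sym_kappa.
  rewrite -[[seq c (enum_val i) | i <- _]]/(map (c \o ev) _) map_comp.
  apply: perm_map; rewrite perm_map_enum eqxx andbT.
  by apply/dinjectiveP => i j _ _; apply: ev_inj.
rewrite /h /h' -imset_comp -[RHS]imset_id; apply: eq_in_imset => b bmu /=.
by rewrite ev'K //; apply: partitionS muS bmu.
Qed.

End Cumulants.

(** * Distributivity of products over sums, and partitions of partitions *)

Section BigChoice.
Variables (K : fieldType) (A : twoMulAlgType K) (o : A) (op : Monoid.com_law o).
Hypothesis op_linear : multilinear_family (fun t : seq A => \big[op/o]_(y <- t) y).

(** The iterated product is itself a symmetric multilinear family, so [multilinear_choice] applies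
    to it. *)
Lemma big_choice (X Y : finType) (supp : X -> Y) (P : pred X)
    (f : X -> A) (Q : pred {set Y}) :
  \sum_(G | Q G) \big[op/o]_(y in G) \sum_(x | P x && (supp x == y)) f x =
  \sum_(F : {set X} | [&& [forall x in F, P x], dinjectiveb supp F
                        & Q (supp @: F)]) \big[op/o]_(x in F) f x.
Proof.
have sym : symmetric_family (fun s => \big[op/o]_(y <- s) y).
  by move=> s t; apply: perm_big.
have := multilinear_choice sym op_linear supp P f Q.
under eq_bigr do rewrite big_map big_enum.
by under [RHS]eq_bigr do rewrite big_map big_enum.
Qed.

Lemma sum_nested_partitions (T : finType) (S : {set T}) (f : {set {set T}} -> A) :
  \sum_(rho | partition rho S)
     \big[op/o]_(B in rho) \sum_(nu | partition nu B) f nu =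
  \sum_(nu | partition nu S) \sum_(s | partition s nu) \big[op/o]_(c in s) f c.
Proof.
(* The inner sum becomes a sum over the fibre of [cover] at [B], the form that [big_choice]
   requires. *)
transitivity (\sum_(rho | partition rho S) \big[op/o]_(B in rho)
    \sum_(nu : {set {set T}} | partition nu (cover nu) && (cover nu == B)) f nu).
  apply: eq_bigr => rho _; apply: eq_bigr => B _; apply: eq_bigl => nu.
  apply/idP/andP => [nuB|[nuB /eqP <-//]].
  by rewrite (cover_partition nuB) eqxx.
rewrite big_choice [RHS](exchange_big_dep predT) //=.
rewrite big_mkcond /=; apply: eq_bigr => s _.
(* On the right, [nu] is determined by [s] as [cover s]. *)
rewrite -nested_partitionE; case: ifP => [/andP[sS ss]|Ns].
  rewrite [RHS](big_pred1 (cover s)) // => nu; apply/andP/eqP => [[_ snu]|->//].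
  by rewrite (cover_partition snu).
rewrite [RHS]big_pred0 // => nu; apply: contraFF Ns => /andP[nuS snu].
by rewrite (cover_partition snu) nuS snu.
Qed.

End BigChoice.

(** * Connected components of a partition *)

Section Components.
Variables (L I : finType) (row : L -> I).
Hypothesis row_surj : forall i, exists x, row x = i.
Implicit Types (b : {set L}) (R B : {set I}) (c d nu : {set {set L}}).
Implicit Type s : {set {set {set L}}}.

Definition linked (b b' : {set L}) := [exists x in b, exists y in b', row x == row y].

Lemma linkedP b b' :
  reflect (exists x y, [/\ x \in b, y \in b' & row x = row y]) (linked b b').
Proof.
apply: (iffP exists_inP) => [[x xb /exists_inP[y yb /eqP e]]|[x [y [xb yb e]]]].
  by exists x, y.
by exists x => //; apply/exists_inP; exists y; rewrite ?e.
Qed.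

Lemma linked_sym b b' : linked b b' = linked b' b.
Proof. by apply/linkedP/linkedP => -[x [y [xb yb e]]]; exists y, x. Qed.

(** Connectedness of the graph of linked blocks, stated without paths: a nonempty subfamily closed
    under linking is everything. The empty family counts as connected. *)
Definition connected_blocks c :=
  [forall d : {set {set L}}, [&& d \subset c, d != set0 &
     [forall b in d, forall b' in c :\: d, ~~ linked b b']] ==> (d == c)].

Lemma connected_blocksP c :
  reflect (forall d, d \subset c -> d != set0 ->
             (forall b b', b \in d -> b' \in c -> linked b b' -> b' \in d) ->
             d = c)
          (connected_blocks c).
Proof.
apply: (iffP forallP) => H d; last first.
  apply/implyP => /and3P[dc d0 /forall_inP cl]; apply/eqP/H => // b b' bd b'c bb'.
  by apply: contraLR bb' => b'd; apply: (forall_inP (cl _ bd)); rewrite inE b'd.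
move=> dc d0 cl; apply/eqP; apply: (implyP (H d)); rewrite dc d0 /=.
apply/forall_inP => b bd; apply/forall_inP => b' /setDP[b'c]; apply: contra.
exact: cl.
Qed.

(** The middle condition says that the labels covered by [c] form a union of complete rows. *)
Definition component c :=
  [&& partition c (cover c), cover c == row @^-1: (row @: cover c)
    & connected_blocks c].

(** A decomposition into components whose sets of rows are distinct and partition [R]; the shape is
    that of the index set in [big_choice]. *)
Definition component_family R s :=
  [&& [forall c in s, component c], dinjectiveb (fun c => row @: cover c) s
    & partition ((fun c => row @: cover c) @: s) R].

Lemma imset_preimset_row B : row @: (row @^-1: B) = B.
Proof.
apply/setP => i; apply/imsetP/idP => [[x + ->]|iB]; first by rewrite inE.
by have [x xi] := row_surj i; exists x; rewrite ?inE xi.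
Qed.

(** Turns the connected partitions over the rows [B] into a fibre of the map from a component to its
    set of rows, for [big_choice]. *)
Lemma componentE B c :
  component c && (row @: cover c == B) =
  partition c (row @^-1: B) && connected_blocks c.
Proof.
apply/andP/andP => [[/and3P[pc /eqP ec cc] /eqP <-]|[pc cc]].
  by rewrite -ec.
by rewrite /component (cover_partition pc) imset_preimset_row pc cc !eqxx.
Qed.

Section Family.
Variables (R : {set I}) (s : {set {set {set L}}}).
Hypothesis sR : component_family R s.

(** Linked blocks share a row, and distinct members of the family have disjoint sets of rows. *)
Lemma component_family_linked c c' b b' :
    c \in s -> c' \in s -> b \in c -> b' \in c' -> linked b b' -> c = c'.
Proof.
move: sR => /and3P[_ /dinjectiveP inj /partition_pointwiseP[_ _ ti _]].
move=> cs c's bc b'c' /linkedP[x [y [xb yb e]]]; apply: inj => //.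
apply: (ti _ _ (row x)); try exact: (imset_f (fun c => row @: cover c)).
  by apply: imset_f; apply/bigcupP; exists b.
by rewrite e; apply: imset_f; apply/bigcupP; exists b'.
Qed.

Lemma component_family_block_neq0 c b : c \in s -> b \in c -> exists x, x \in b.
Proof.
move: sR => /and3P[/forall_inP comp _ _] cs bc.
have /and3P[/partition_pointwiseP[_ _ _ ne] _ _] := comp _ cs.
exact: ne.
Qed.

Lemma component_family_neq0 c : c \in s -> c != set0.
Proof.
move: sR => /and3P[_ _ /partition_pointwiseP[_ _ _ ne]] cs.
have [i] := ne _ (imset_f (fun c => row @: cover c) cs).
by move=> /imsetP[x /bigcupP[b bc _] _]; apply/set0Pn; exists b.
Qed.

Lemma component_family_trivIset : trivIset s.
Proof.
apply/trivIsetP => c c' cs c's; apply: contraR => /pred0Pn[b /andP[bc bc']].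
have [x xb] := component_family_block_neq0 cs bc.
apply/eqP; apply: (component_family_linked cs c's bc bc').
by apply/linkedP; exists x, x.
Qed.

Lemma component_family_partition : partition (cover s) (row @^-1: R).
Proof.
have /and3P[/forall_inP comp /dinjectiveP inj] := sR.
move=> /partition_pointwiseP[sub cov ti _].
apply/partition_pointwiseP; split.
- move=> b x /bigcupP[c cs bc] xb; rewrite inE.
  apply: (sub (row @: cover c)); first exact: (imset_f (fun c => row @: cover c)).
  by apply: imset_f; apply/bigcupP; exists b.
- move=> x; rewrite inE => /cov[_ /imsetP[c cs ->] xc].
  have /and3P[_ /eqP ec _] := comp _ cs.
  have /bigcupP[b bc xb] : x \in cover c by rewrite ec inE.
  by exists b => //; apply/bigcupP; exists c.
- move=> b b' x /bigcupP[c cs bc] /bigcupP[c' c's b'c'] xb xb'.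
  have cc' : c = c'.
    apply: (component_family_linked cs c's bc b'c').
    by apply/linkedP; exists x, x.
  subst c'; have /and3P[/partition_pointwiseP[_ _ tic _] _ _] := comp _ cs.
  exact: (tic _ _ x).
- by move=> b /bigcupP[c cs bc]; apply: component_family_block_neq0 cs bc.
Qed.

End Family.

(** Uniqueness of the decomposition. If [d] and [d'], one from each family, share a block, then
    their intersection is closed under linking in both, hence equals both by connectedness. *)
Lemma component_family_sub R s s' c :
    component_family R s -> component_family R s' -> cover s = cover s' ->
  c \in s -> c \in s'.
Proof.
move=> sR s'R ss' cs; have /set0Pn[b bc] := component_family_neq0 sR cs.
have /bigcupP[c' c's' bc'] : b \in cover s' by rewrite -ss'; apply/bigcupP; exists c.
have compat t : component_family R t -> {in t, forall c, connected_blocks c}.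
  by move=> /and3P[/forall_inP ct _ _] c0 /ct/and3P[].
suff incl t t' d d' : component_family R t -> component_family R t' ->
    cover t = cover t' -> d \in t -> d' \in t' -> b \in d -> b \in d' ->
    d :&: d' = d.
  by rewrite -(incl s s' c c') // setIC (incl s' s c' c).
move=> tR t'R tt' dt d't' bd bd'.
apply: (connected_blocksP _ (compat _ tR _ dt)); first exact: subsetIl.
  by apply/set0Pn; exists b; rewrite inE bd.
move=> b1 b2 /setIP[_ b1d'] b2d b12; rewrite inE b2d /=.
have /bigcupP[d2 d2t' b2d2] : b2 \in cover t'.
  by rewrite -tt'; apply/bigcupP; exists d.
by rewrite (component_family_linked t'R d't' d2t' b1d' b2d2 b12).
Qed.

(** Existence of the decomposition: its members are the classes of blocks joined by a path of
    links. *)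
Lemma component_family_exists R nu :
  partition nu (row @^-1: R) -> exists2 s, component_family R s & cover s = nu.
Proof.
move=> nuR; pose e := [rel b b' | [&& b \in nu, b' \in nu & linked b b']].
have e_sym : connect_sym e.
  by apply: sym_connect_sym => b b'; rewrite /= linked_sym andbCA.
have eqR : {in nu & &, equivalence_rel (connect e)}.
  move=> b1 b2 b3 _ _ _; split=> // b12; apply/idP/idP.
    by rewrite e_sym in b12; apply: connect_trans.
  exact: connect_trans.
have snu := equivalence_partitionP eqR; set s := equivalence_partition _ _ in snu.
have [sub cov ti ne] := partition_pointwiseP _ _ nuR.
have [subs covs tis nes] := partition_pointwiseP _ _ snu.
have cl c b b' : c \in s -> b \in c -> b' \in nu -> linked b b' -> b' \in c.
  move=> cs bc b'nu bb'; have bnu := subs _ _ cs bc.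
  move: cs bc => /imsetP[b0 b0nu ->]; rewrite !inE b'nu /= => /andP[_ b0b].
  by apply: connect_trans b0b (connect1 _); rewrite /= bnu b'nu.
have con c b b' : c \in s -> b \in c -> b' \in c -> connect e b b'.
  move=> /imsetP[b0 b0nu ->]; rewrite !inE => /andP[bnu b0b] /andP[_ b0b'].
  by rewrite e_sym in b0b; apply: connect_trans b0b b0b'.
have rowcov c i : c \in s -> i \in row @: cover c ->
    exists b x, [/\ b \in c, x \in b & row x = i].
  by move=> cs /imsetP[x /bigcupP[b bc xb] ->]; exists b, x.
have eqc c c' i : c \in s -> c' \in s -> i \in row @: cover c ->
    i \in row @: cover c' -> c = c'.
  move=> cs c's /(rowcov _ _ cs)[b [x [bc xb <-]]].
  move=> /(rowcov _ _ c's)[b' [y [b'c' yb' e']]].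
  apply: (tis _ _ b') => //; apply: (cl _ _ _ cs bc); first exact: subs c's b'c'.
  by apply/linkedP; exists x, y.
have nerow c : c \in s -> exists i, i \in row @: cover c.
  move=> cs; have [b bc] := nes _ cs; have [x xb] := ne _ (subs _ _ cs bc).
  by exists (row x); apply: imset_f; apply/bigcupP; exists b.
exists s; last exact: cover_partition snu.
apply/and3P; split.
- apply/forall_inP => c cs; apply/and3P; split.
  + apply/partition_pointwiseP; split.
    * by move=> b x bc xb; apply/bigcupP; exists b.
    * by move=> x /bigcupP[b bc xb]; exists b.
    * by move=> b b' x bc b'c; apply: ti; apply: subs cs _.
    * by move=> b bc; apply: ne; apply: subs cs _.
  (* Completeness of rows: the block of [nu] containing a label from a row met by [c] is linked to
     [c], hence lies in it. *)
  + apply/eqP/setP => x; rewrite inE; apply/idP/idP => [|xc]; first exact: imset_f.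
    have [b [y [bc yb yx]]] := rowcov _ _ cs xc.
    have xR : x \in row @^-1: R.
      by have := sub _ _ (subs _ _ cs bc) yb; rewrite !inE yx.
    have [b' b'nu xb'] := cov _ xR; apply/bigcupP; exists b' => //.
    by apply: (cl _ _ _ cs bc b'nu); apply/linkedP; exists y, x.
  (* A closed subfamily containing [b] is followed along a path from [b] to any other block of the
     class. *)
  + apply/connected_blocksP => d dc /set0Pn[b bd] dcl.
    apply/eqP; rewrite eqEsubset dc; apply/subsetP => b' b'c.
    have /connectP[p] := con _ _ _ cs (subsetP dc _ bd) b'c.
    elim: p b bd {b'c} => [|b1 p IHp] b bd /= => [_ ->//|].
    case/andP=> /and3P[_ b1nu bb1] pp eb'; apply: (IHp b1) => //.
    by apply: (dcl b) => //; apply: (cl _ b) => //; apply: (subsetP dc).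
- apply/dinjectiveP => c c' cs c's /= ecc'; have [i ic] := nerow _ cs.
  by apply: (eqc _ _ i) => //; rewrite -ecc'.
apply/partition_pointwiseP; split.
- move=> _ i /imsetP[c cs ->] /(rowcov _ _ cs)[b [x [bc xb <-]]].
  by have := sub _ _ (subs _ _ cs bc) xb; rewrite inE.
- move=> i iR; have [x xi] := row_surj i.
  have [|b bnu xb] := cov x; first by rewrite inE xi.
  have [c cs bc] := covs _ bnu; exists (row @: cover c).
    exact: (imset_f (fun c => row @: cover c)).
  by rewrite -xi; apply: imset_f; apply/bigcupP; exists b.
- move=> _ _ i /imsetP[c cs ->] /imsetP[c' c's ->] ic ic'.
  by rewrite (eqc _ _ _ cs c's ic ic').
- by move=> _ /imsetP[c cs ->]; apply: nerow.
Qed.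

Section Sum.
Variables (K : fieldType) (A : twoMulAlgType K) (o : A) (op : Monoid.com_law o).
Hypothesis op_linear : multilinear_family (fun t : seq A => \big[op/o]_(y <- t) y).

(** By distributivity the left side runs over component families; [cover] matches these with the
    partitions [nu], one family for each. *)
Lemma sum_components R (f : {set L} -> A) :
  \sum_(rho | partition rho R) \big[op/o]_(B in rho)
    \sum_(c | partition c (row @^-1: B) && connected_blocks c)
      \big[op/o]_(b in c) f b =
  \sum_(nu | partition nu (row @^-1: R)) \big[op/o]_(b in nu) f b.
Proof.
under eq_bigr do under eq_bigr do under eq_bigl do rewrite -componentE.
rewrite big_choice // (partition_big cover [pred nu | partition nu (row @^-1: R)]) /=;
  last by move=> s; apply: component_family_partition.
apply: eq_bigr => nu nuR; have [s sR <-] := component_family_exists nuR.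
rewrite (big_pred1 s) => [|s'].
  by rewrite big_trivIset // (component_family_trivIset sR).
apply/andP/eqP => [[s'R /eqP es]|->//]; apply/setP => c.
by apply/idP/idP; apply: (component_family_sub (R := R)).
Qed.

End Sum.
End Components.

(** * Sums over trees *)

Lemma uniq_flatten_map (X L : eqType) (lab : X -> seq L) (r : seq X) : uniq r ->
  reflect ({in r, forall c, uniq (lab c)} /\
           {in r &, forall c c' x, x \in lab c -> x \in lab c' -> c = c'})
          (uniq (flatten [seq lab c | c <- r])).
Proof.
elim: r => [_|c r IHr /= /andP[cr ur]]; first by constructor; split.
rewrite cat_uniq; apply: (iffP and3P) => [[uc /hasPn dis /(IHr ur)[u inj]]|[u inj]].
  split=> [c'|c1 c2]; rewrite !inE; first by move=> /predU1P[->//|/u].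
  have notin c' x : c' \in r -> x \in lab c -> x \in lab c' -> c = c'.
    move=> c'r xc xc'; have /dis/negP[//] : x \in flatten [seq lab i | i <- r].
    by apply/flattenP; exists (lab c') => //; apply: map_f.
  move=> /predU1P[->|c1r] /predU1P[->|c2r] x //; first exact: notin.
    by move=> x1 x2; apply/esym/(notin _ x).
  exact: inj.
split; first by apply: u; rewrite mem_head.
  apply/hasPn => x /flattenP[_ /mapP[c' c'r ->] xc']; apply/negP => xc.
  by move: cr; rewrite (inj c c' _ _ x) ?c'r // inE ?eqxx ?c'r ?orbT.
apply/(IHr ur); split=> [c' c'r|c1 c2 c1r c2r]; first by apply: u; rewrite inE c'r orbT.
by apply: inj; rewrite inE ?c1r ?c2r orbT.
Qed.

(** Translates the bijective labelling of a tree or forest into a partition by the label sets.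
    Nonempty label lists make equal label sets produce a common label, and make the blocks
    nonempty. *)
Lemma uniq_flatten_partition (X L : finType) (lab : X -> seq L) (C : {set X})
    (S : {set L}) :
    (forall c, c \in C -> lab c != [::]) ->
  uniq (flatten [seq lab c | c <- enum C]) &&
    ([set x in flatten [seq lab c | c <- enum C]] == S) =
  [&& [forall c in C, uniq (lab c)], dinjectiveb (fun c => [set x in lab c]) C
    & partition ((fun c => [set x in lab c]) @: C) S].
Proof.
move=> ne; pose sup c := [set x in lab c].
have supF c : c \in C -> sup c \in sup @: C by apply: imset_f.
apply/andP/and3P => [[/(uniq_flatten_map lab (enum_uniq _))[u inj] /eqP <-]|].
  split.
  - by apply/forall_inP => c cC; apply: u; rewrite mem_enum.
  - apply/dinjectiveP => c c' cC c'C /setP e.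
    have : exists x, x \in lab c.
      by case: (lab c) (ne _ cC) => // x s _; exists x; rewrite mem_head.
    case=> x xc; apply: (inj c c' _ _ x); rewrite ?mem_enum //.
    by have := e x; rewrite !inE xc => <-.
  apply/partition_pointwiseP; split.
  - move=> _ x /imsetP[c cC ->]; rewrite !inE => xc.
    by apply/flattenP; exists (lab c) => //; apply: map_f; rewrite mem_enum.
  - move=> x; rewrite inE => /flattenP[_ /mapP[c cC ->] xc].
    by exists (sup c); rewrite ?inE // supF // -mem_enum.
  - move=> _ _ x /imsetP[c cC ->] /imsetP[c' c'C ->]; rewrite !inE => xc xc'.
    by rewrite (inj c c' _ _ x) ?mem_enum.
  - move=> _ /imsetP[c cC ->]; case: (lab c) (ne _ cC) => // x s _; exists x.
    by rewrite inE mem_head.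
case=> /forall_inP u /dinjectiveP inj /partition_pointwiseP[sub cov ti _].
split.
  apply/(uniq_flatten_map lab (enum_uniq _)); split=> [c|c c']; rewrite !mem_enum.
    exact: u.
  move=> cC c'C x xc xc'; apply: inj => //.
  by apply: (ti _ _ x) => //; rewrite ?supF ?inE.
apply/eqP/setP => x; rewrite inE; apply/flattenP/idP => [[_ /mapP[c cC ->] xc]|].
  by apply: (sub (sup c)); rewrite ?inE // supF // -mem_enum.
case/cov=> _ /imsetP[c cC ->]; rewrite inE => xc; exists (lab c) => //.
by apply: map_f; rewrite mem_enum.
Qed.

Section TreeCombinatorics.
Variable L : finType.

Definition support d (t : utree L d) : {set L} := [set x in leaf_labels t].

(** The contribution of one tree to the weight; the subtraction never truncates, by
    [leq_labels_vertices]. *)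
Definition excess d (t : utree L d) : nat := (nb_vertices t - size (leaf_labels t))%N.

Lemma leaf_labels_leaf d x : leaf_labels (leaf d x : utree L d) = [:: x].
Proof. by case: d. Qed.

Lemma size_flatten_enum (X : finType) (lab : X -> seq L) (C : {set X}) :
  size (flatten [seq lab c | c <- enum C]) = (\sum_(c in C) size (lab c))%N.
Proof. by rewrite size_flatten /shape -map_comp sumnE big_map big_enum. Qed.

Lemma reduced_labels d (t : utree L d) : reduced t -> leaf_labels t != [::].
Proof.
elim: d t => [//|d IHd] [//|C] /= /andP[C1 /forall_inP rC].
have /card_gt0P[c cC] : (0 < #|C|)%N by apply: ltnW.
rewrite -size_eq0 size_flatten_enum (bigD1 c) //=.
by have := IHd _ (rC _ cC); rewrite -size_eq0; case: size.
Qed.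

Lemma leq_labels_vertices d (t : utree L d) :
  (size (leaf_labels t) <= nb_vertices t)%N.
Proof.
elim: d t => [//|d IHd] [//|C] /=; rewrite size_flatten_enum.
by rewrite leqW // leq_sum.
Qed.

Lemma excess_node d (C : {set utree L d}) :
  excess (inr C : utree L d.+1) = (\sum_(c in C) excess c).+1.
Proof.
rewrite /excess /= size_flatten_enum sumnB => [|c _]; last exact: leq_labels_vertices.
by rewrite add1n subSn // leq_sum // => c _; apply: leq_labels_vertices.
Qed.

(** An inner vertex of a reduced tree has at least two children, each carrying at least one
    label. *)
Lemma reduced_singleton d (t : utree L d) x :
  reduced t -> leaf_labels t = [:: x] -> t = leaf d x.
Proof.
case: d t => [y _ [->]|d] // [y _ [->]//|C] /= /andP[C1 /forall_inP rC].
move/(congr1 size); rewrite /= size_flatten_enum => sC.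
move: C1; rewrite ltnNge -sC -sum1_card leq_sum // => c cC.
by rewrite lt0n size_eq0 reduced_labels ?rC.
Qed.

End TreeCombinatorics.

(** * Signed sums of mixing reduced trees with a prescribed label set *)

Section TreeSums.
Variables (L I : finType) (row : L -> I).
Variables (K : fieldType) (A : twoMulAlgType K) (kappa : seq A -> A) (a : L -> A).
Hypotheses (kappa_sym : symmetric_family kappa) (kappa_lin : multilinear_family kappa).

Definition single_row (S : {set L}) := [forall x in S, forall y in S, row x == row y].

(* [pi] is the partition of the labels [S] by the children of the root. *)
Definition mixing_children (pi : {set {set L}}) (S : {set L}) :=
  [forall B in pi, #|B| == 1%N] ==> ~~ single_row S.

Definition good_tree d (t : utree L d) :=
  [&& reduced t, mixing row t & uniq (leaf_labels t)].

Definition tree_value d (t : utree L d) :=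
  (-1) ^+ excess t *: kappa_tree kappa a t.

Definition tree_sum d (S : {set L}) : A :=
  \sum_(t : utree L d | good_tree t && (support t == S)) tree_value t.

(** The mixing condition at the root depends only on the partition by children: a good tree is a
    leaf exactly when its support is a singleton. *)
Lemma mixing_nodeE d (C : {set utree L d}) S :
    [forall c in C, good_tree c] -> partition (@support L d @: C) S ->
  ([forall c in C, [exists x, c == leaf d x]] ==>
     [exists x, exists y, [&& leaf d x \in C, leaf d y \in C & row x != row y]]) =
  mixing_children (@support L d @: C) S.
Proof.
move=> /forall_inP gC /partition_pointwiseP[sub cov _ _].
have suppleaf x : support (leaf d x) = [set x].
  by apply/setP => y; rewrite !inE leaf_labels_leaf inE.
have -> : [forall c in C, [exists x, c == leaf d x]] =
    [forall B in @support L d @: C, #|B| == 1%N].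
  apply/forall_inP/forall_inP => [lC _ /imsetP[c cC ->]|B1 c cC].
    by have /existsP[x /eqP ->] := lC _ cC; rewrite suppleaf cards1.
  have /and3P[rc _ uc] := gC _ cC.
  have := B1 _ (imset_f _ cC); rewrite cardsE => /eqP /=.
  move/card_uniqP: uc => ->.
  case e : (leaf_labels c) => [|x []] // _; apply/existsP; exists x.
  by apply/eqP; apply: reduced_singleton.
rewrite /mixing_children.
case: (boolP [forall B in @support L d @: C, #|B| == 1%N]) => [/forall_inP B1 /=|//].
have leafC x : (leaf d x \in C) = (x \in S).
  apply/idP/idP => [xC|/cov[_ /imsetP[c cC ->] xc]].
    by apply: (sub _ _ (imset_f _ xC)); rewrite suppleaf set11.
  have /and3P[rc _ uc] := gC _ cC.
  have := B1 _ (imset_f _ cC); rewrite cardsE => /eqP /=.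
  move/card_uniqP: uc => ->; move: xc; rewrite inE.
  case e : (leaf_labels c) => [|y []] //; rewrite inE => /eqP -> _.
  by rewrite -(reduced_singleton rc e).
rewrite /single_row negb_forall; apply: eq_existsb => x.
rewrite negb_imply negb_forall leafC; apply/existsP/andP => [[y]|[xS /existsP[y]]].
  rewrite leafC => /and3P[-> yS rxy]; split=> //; apply/existsP; exists y.
  by rewrite negb_imply yS.
by rewrite negb_imply => /andP[yS rxy]; exists y; rewrite leafC xS yS.
Qed.

(** Decomposition at the root, in the shape of the index set of [multilinear_choice]. *)
Lemma good_nodeE d (C : {set utree L d}) S :
  good_tree (inr C : utree L d.+1) && (support (inr C : utree L d.+1) == S) =
  [&& [forall c in C, good_tree c], dinjectiveb (@support L d) C &
      [&& partition (@support L d @: C) S, (1 < #|@support L d @: C|)%N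
        & mixing_children (@support L d @: C) S]].
Proof.
apply/andP/and3P => [[/and3P[/= /andP[C1 rC] /andP[mC mmC] uC] eS]|].
  have ne c : c \in C -> leaf_labels c != [::].
    by move=> cC; apply: reduced_labels; apply: (forall_inP rC).
  have := uniq_flatten_partition S ne; rewrite uC eS => /esym/and3P[uc inj pS].
  have gC : [forall c in C, good_tree c].
    apply/forall_inP => c cC.
    by rewrite /good_tree (forall_inP rC) // (forall_inP mmC) // (forall_inP uc).
  split=> //; rewrite -(mixing_nodeE gC pS) mC card_in_imset ?pS ?C1 //.
  exact/dinjectiveP.
move=> [gC inj /and3P[pS C1]]; rewrite -(mixing_nodeE gC pS) => mC.
have ne c : c \in C -> leaf_labels c != [::].
  by move=> cC; have /and3P[rc _ _] := forall_inP gC _ cC; apply: reduced_labels.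
have uc : [forall c in C, uniq (leaf_labels c)].
  by apply/forall_inP => c cC; have /and3P[] := forall_inP gC _ cC.
have := uniq_flatten_partition S ne; rewrite uc inj pS => /andP[uC eS].
split=> //; apply/and3P; split=> //=.
  rewrite card_in_imset in C1; last exact/dinjectiveP.
  rewrite C1; apply/forall_inP => c cC.
  by have /and3P[] := forall_inP gC _ cC.
by rewrite mC; apply/forall_inP => c cC; have /and3P[] := forall_inP gC _ cC.
Qed.

(** The root adds one inner vertex, whence the sign; the signs of the children come out by
    multilinearity. *)
Lemma tree_value_node d (C : {set utree L d}) :
  tree_value (inr C : utree L d.+1) = - kappa [seq tree_value c | c <- enum C].
Proof.
rewrite /tree_value multilinear_scales // excess_node exprS mulN1r scaleNr.
by rewrite prodrXr big_enum.
Qed.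

Lemma tree_sum_rec d S :
  tree_sum d.+1 S = \sum_(x | [set x] == S) a x -
    \sum_(pi | [&& partition pi S, (1 < #|pi|)%N & mixing_children pi S])
       kappa [seq tree_sum d B | B <- enum pi].
Proof.
(* The two summands of the tree type give the leaves and the trees with an inner root. *)
rewrite /tree_sum [LHS]big_sumType /=; congr (_ + _).
  apply: eq_big => [x|x _]; last by rewrite /tree_value /excess /= expr0 scale1r.
  by congr (_ == _); apply/setP => y; rewrite !inE.
rewrite (multilinear_choice kappa_sym kappa_lin (@support L d) (@good_tree d)
  (@tree_value d) (fun pi => [&& partition pi S, (1 < #|pi|)%N & mixing_children pi S])).
rewrite -sumrN; apply: eq_big => [C|C _]; last exact: tree_value_node.
exact: good_nodeE.
Qed.

Implicit Type S : {set L}.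

(** The height bound is immaterial once it is large enough: blocks of a partition with at least two
    blocks are strictly smaller, so the recursion stops in time. For [d = 0] only leaves remain. *)
Lemma tree_sum_height d S :
  (#|S| <= d.+1)%N -> tree_sum d.+1 S = tree_sum d S.
Proof.
elim: d S => [|d IHd] S cS; last first.
  rewrite !tree_sum_rec; congr (_ - _); apply: eq_bigr => pi /and3P[piS pi1 _].
  congr kappa; apply/eq_in_map => B; rewrite mem_enum => Bpi; apply: IHd.
  by rewrite -ltnS (leq_trans (partition_block_card piS pi1 Bpi)).
rewrite tree_sum_rec [X in _ - X]big_pred0 => [|pi]; last first.
  by apply/and3P => -[/partition_card_le/(_ cS)]; rewrite leqNgt => /negP.
rewrite subr0 /tree_sum; apply: eq_big => [x|x _].
  by congr (_ == _); apply/setP => y; rewrite !inE.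
by rewrite /tree_value /excess /= expr0 scale1r.
Qed.

Definition tree_total := tree_sum #|L|.

Lemma tree_total_rec S :
  tree_total S = \sum_(x | [set x] == S) a x -
    \sum_(pi | [&& partition pi S, (1 < #|pi|)%N & mixing_children pi S])
       kappa [seq tree_total B | B <- enum pi].
Proof. by rewrite -tree_sum_rec tree_sum_height // leqW // max_card. Qed.

Lemma tree_total1 x : tree_total [set x] = a x.
Proof.
rewrite tree_total_rec (big_pred1 x) => [|y]; last by rewrite (inj_eq set1_inj).
rewrite big_pred0 ?subr0 // => pi; apply/and3P => -[piS pi1 _].
by move: pi1; rewrite ltnNge (partition_card_le piS) ?cards1.
Qed.

Hypothesis kappa1 : forall y, kappa [:: y] = y.

(** The one-block term is [tree_total S] by [kappa1]; by the recursion it cancels every other term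
    except the partition into singletons of a set within one row, which the recursion leaves out. *)
Lemma sum_kappa_tree_total S : S != set0 ->
  \sum_(pi | partition pi S) kappa [seq tree_total B | B <- enum pi] =
  if single_row S then kappa [seq a x | x <- enum S] else 0.
Proof.
(* A singleton is treated apart, because its one-block partition is also its partition into
   singletons. *)
move=> S0; have [S1|S1] := leqP #|S| 1.
  have /cards1P[x Sx] : #|S| == 1%N by rewrite eqn_leq S1 card_gt0.
  have -> : single_row S.
    apply/forall_inP => y; rewrite Sx => /set1P->.
    by apply/forall_inP => z /set1P->.
  rewrite (big_pred1 [set S]) => [|pi].
    by rewrite !enum_set1 Sx enum_set1 /= tree_total1.
  apply/idP/eqP => [piS|->]; last exact: partition_set1.
  by apply/eqP; rewrite -(partition_card_le1 S0 piS) (partition_card_le piS).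
rewrite (bigID (fun pi : {set {set L}} => 1 < #|pi|)%N) /= addrC.
rewrite (big_pred1 [set S]) => [|pi]; last first.
  apply/andP/eqP => [[piS]|->]; last by rewrite partition_set1 ?cards1.
  by rewrite -leqNgt (partition_card_le1 S0 piS) => /eqP.
rewrite enum_set1 /= kappa1 tree_total_rec [X in X - _]big_pred0 => [|x]; last first.
  by apply: contraTF S1 => /eqP <-; rewrite cards1.
rewrite sub0r; under [X in - X + _]eq_bigl do rewrite andbA.
rewrite [X in _ + X](bigID (mixing_children^~ S)) /= addKr.
set sing := [set [set x] | x in S].
have singP pi : partition pi S && (1 < #|pi|)%N && ~~ mixing_children pi S =
                single_row S && (pi == sing).
  rewrite negb_imply negbK; apply/andP/andP => [[/andP[piS _] /andP[/forall_inP B1 ->]]|].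
    by split=> //; apply/eqP/(partition_in_singletons piS).
  case=> -> /eqP ->; rewrite partition_singletons card_imset ?S1; last exact: set1_inj.
  split=> //; apply/andP; split=> //.
  by apply/forall_inP => _ /imsetP[x _ ->]; rewrite cards1.
rewrite (eq_bigl _ _ singP); case: single_row => /=; last by rewrite big_pred0_eq.
rewrite big_pred1_eq.
(* The singleton blocks need not be enumerated in the order of [S]; symmetry of [kappa] bridges
   this. *)
apply: etrans (_ : kappa [seq tree_total [set x] | x <- enum S] = _).
  rewrite -[[seq tree_total [set x] | x <- _]]/(map (tree_total \o _) _) map_comp.
  apply/kappa_sym/perm_map; rewrite perm_sym.
  rewrite perm_map_enum eqxx andbT; apply/dinjectiveP => x y _ _; exact: set1_inj.
by congr kappa; apply: eq_map => x; rewrite tree_total1.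
Qed.

End TreeSums.

(** * Sums over forests *)

Lemma bilinear_multilinear (K : fieldType) (A : twoMulAlgType K) (o : A)
    (op : Monoid.com_law o) :
    (forall x, linear (op x)) ->
  multilinear_family (fun t : seq A => \big[op/o]_(y <- t) y).
Proof.
move=> lin s t k x y; rewrite !big_cat !big_cons /=.
have opAC z : op (\big[op/o]_(i <- s) i) (op z (\big[op/o]_(i <- t) i)) =
    op (op (\big[op/o]_(i <- s) i) (\big[op/o]_(i <- t) i)) z.
  by rewrite -Monoid.mulmA [op z _]Monoid.mulmC.
by rewrite !opAC lin.
Qed.

Section Forests.
Variables (L I : finType) (row : L -> I).
Variables (K : fieldType) (A : twoMulAlgType K) (kappa : seq A -> A) (a : L -> A).
Hypotheses (kappa_sym : symmetric_family kappa) (kappa_lin : multilinear_family kappa).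

Lemma weight_excess (F : forest L) : weight F = (\sum_(t in F) excess t)%N.
Proof.
rewrite /weight /forest_labels size_flatten_enum sumnB // => t _.
exact: leq_labels_vertices.
Qed.

(** Presents the forests as choices of a good tree over each block of a strongly mixing partition,
    ready for [big_choice]. *)
Lemma strongly_mixing_reduced_forestE (F : forest L) :
  strongly_mixing_reduced_forest row F =
  [&& [forall t in F, good_tree row t], dinjectiveb (@support L #|L|) F &
      partition (@support L #|L| @: F) [set: L] &&
      strongly_mixing_partition row (@support L #|L| @: F)].
Proof.
have labelsE : perm_eq (forest_labels F) (enum L) =
    uniq (forest_labels F) && ([set x in forest_labels F] == setT).
  apply/idP/andP => [pe|[u /eqP/setP e]].
    rewrite (perm_uniq pe) enum_uniq; split=> //.
    by apply/eqP/setP => x; rewrite !inE (perm_mem pe) mem_enum.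
  apply: uniq_perm => //; first exact: enum_uniq.
  by move=> x; have := e x; rewrite !inE mem_enum => ->.
rewrite /strongly_mixing_reduced_forest /reduced_forest labelsE.
apply/and3P/and3P => [[/andP[uF rF] mF smF]|[gF inj /andP[pF smF]]].
  have ne t : t \in F -> leaf_labels t != [::].
    by move=> tF; apply: reduced_labels; apply: (forall_inP rF).
  move: uF; rewrite uniq_flatten_partition // => /and3P[ut inj pF].
  split=> //; last by apply/andP; split.
  apply/forall_inP => t tF.
  by rewrite /good_tree (forall_inP rF) // (forall_inP mF) // (forall_inP ut).
have ne t : t \in F -> leaf_labels t != [::].
  by move=> tF; have /and3P[rt _ _] := forall_inP gF _ tF; apply: reduced_labels.
split=> //; last by apply/forall_inP => t tF; have /and3P[] := forall_inP gF _ tF.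
rewrite uniq_flatten_partition //; apply/andP; split.
  apply/and3P; split=> //.
  by apply/forall_inP => t tF; have /and3P[] := forall_inP gF _ tF.
by apply/forall_inP => t tF; have /and3P[] := forall_inP gF _ tF.
Qed.

Lemma sum_strongly_mixing_forests :
  \sum_(F : forest L | strongly_mixing_reduced_forest row F)
    (-1) ^+ weight F *: kappa_forest kappa a F =
  \sum_(nu | partition nu [set: L] && strongly_mixing_partition row nu)
    \big[star/star1]_(b in nu) tree_total row kappa a b.
Proof.
have lin := bilinear_multilinear (op := star) (@star_linear K A).
rewrite (big_choice lin (@support L #|L|) (@good_tree L I row #|L|)
  (@tree_value L K A kappa a #|L|)
  (fun nu => partition nu [set: L] && strongly_mixing_partition row nu)).
apply: eq_big => [F|F _]; first exact: strongly_mixing_reduced_forestE.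
(* The weight is additive over trees, so the sign of the forest is the product of the signs of its
   trees. *)
rewrite weight_excess -[in RHS]big_enum -[in RHS](big_map _ predT id).
by rewrite (multilinear_scales lin) prodrXr big_map !big_enum.
Qed.

(** * Strong mixing as connectedness, and the recursion over sets of rows *)

Section Rows.
Hypothesis row_surj : forall i, exists x, row x = i.

(** If each block lies in one row, the blocks meeting a given row are closed under linking, so by
    connectedness there is no other row. *)
Lemma connected_single_rows (B : {set I}) (c : {set {set L}}) :
    partition c (row @^-1: B) -> connected_blocks row c ->
  (forall b, b \in c -> single_row row b) -> (#|B| <= 1)%N.
Proof.
move=> cB cc srow; apply/card_le1_eqP => i j iB jB.
have [sub cov _ _] := partition_pointwiseP _ _ cB.
have srowP b x y : b \in c -> x \in b -> y \in b -> row x = row y.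
  by move=> bc xb yb; apply/eqP; apply: (forall_inP (forall_inP (srow _ bc) _ xb)).
have [x xi] := row_surj i; have [y yj] := row_surj j.
have [|b bc xb] := cov x; first by rewrite inE xi.
have [|b' b'c yb'] := cov y; first by rewrite inE yj.
pose d := [set b in c | [exists x in b, row x == i]].
have dc : d = c.
  apply: (connected_blocksP _ _ cc).
  - by apply/subsetP => b0; rewrite inE => /andP[].
  - apply/set0Pn; exists b; rewrite inE bc; apply/exists_inP; exists x => //.
    exact/eqP.
  - move=> b1 b2; rewrite !inE => /andP[b1c /exists_inP[z zb1 /eqP zi]] b2c.
    move=> /linkedP[u [v [ub1 vb2 uv]]]; rewrite b2c; apply/exists_inP; exists v => //.
    by rewrite -uv (srowP b1 u z) // zi.
move: b'c; rewrite -dc inE => /andP[b'c /exists_inP[z zb' /eqP <-]].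
by rewrite -yj; apply: (srowP b').
Qed.

Lemma connected_one_row i (c : {set {set L}}) :
  partition c (row @^-1: [set i]) -> connected_blocks row c.
Proof.
move=> /partition_pointwiseP[sub _ _ ne]; apply/connected_blocksP => d dc.
case/set0Pn=> b bd cl; apply/eqP; rewrite eqEsubset dc; apply/subsetP => b' b'c.
apply: (cl b) => //; have bc := subsetP dc _ bd.
have [x xb] := ne _ bc; have [y yb'] := ne _ b'c.
apply/linkedP; exists x, y; split=> //.
by have := sub _ _ bc xb; have := sub _ _ b'c yb'; rewrite !inE => /eqP-> /eqP->.
Qed.

(** Closed proper nonempty subfamilies of blocks correspond to row partitions compatible with [nu],
    through the union of their blocks. *)
Lemma strongly_mixing_connected (nu : {set {set L}}) :
  partition nu [set: L] -> strongly_mixing_partition row nu = connected_blocks row nu.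
Proof.
move=> nuT; have [_ cov ti ne] := partition_pointwiseP _ _ nuT.
apply/idP/idP => [sm|cc]; last first.
  apply/existsP => -[lam /andP[/and3P[lamT /eqP lam2 /forallP rlam] /forall_inP blam]].
  have [_ covl til nel] := partition_pointwiseP _ _ lamT.
  have [l [l' [ll' elam]]] : exists l l', l != l' /\ lam = [set l; l'].
    by apply/cards2P/eqP.
  have ll : l \in lam by rewrite elam !inE eqxx.
  have l'l : l' \in lam by rewrite elam !inE eqxx orbT.
  have sep b l0 x : b \in nu -> l0 \in lam -> x \in b -> x \in l0 -> b \subset l0.
    move=> /blam/exists_inP[l1 l1l bl1] l0l xb xl0.
    by rewrite (til l0 l1 x) // (subsetP bl1).
  have rsep l0 x y : l0 \in lam -> row x = row y -> x \in l0 -> y \in l0.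
    move=> l0l xy xl0; have /exists_inP[l1 l1l /subsetP rl1] := rlam (row x).
    by rewrite (til l0 l1 x) ?rl1 ?inE ?xy.
  (* This subfamily is closed under linking because rows do not cross [l]; connectedness then leaves
     no block for [l']. *)
  pose d := [set b in nu | b \subset l].
  have dnu : d = nu.
    apply: (connected_blocksP _ _ cc).
    - by apply/subsetP => b; rewrite inE => /andP[].
    - have [x xl] := nel _ ll; have [|b bnu xb] := cov x; first by rewrite inE.
      by apply/set0Pn; exists b; rewrite inE bnu (sep b l x).
    - move=> b b'; rewrite !inE => /andP[bnu /subsetP bl] b'nu.
      move=> /linkedP[x [y [xb yb' xy]]].
      by rewrite b'nu (sep b' l y) // (rsep l x y) ?bl.
  have [x xl'] := nel _ l'l; have [|b bnu xb] := cov x; first by rewrite inE.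
  have : x \in l by move: bnu; rewrite -dnu inE => /andP[_ /subsetP->].
  by move=> xl; rewrite (til l l' x) ?eqxx in ll'.
apply/connected_blocksP => d dnu d0 cl; apply: contraNeq sm => ndnu.
(* A closed proper subfamily [d] and its complement cover disjoint sets of labels, and closedness
   prevents a row from meeting both. *)
apply/existsP; exists [set cover d; cover (nu :\: d)].
have /set0Pn[b0 b0d] := d0.
have /set0Pn[b1 b1d] : nu :\: d != set0.
  by apply: contra ndnu; rewrite setD_eq0 eqEsubset dnu.
have [x0 x0b0] := ne _ (subsetP dnu _ b0d).
have [x1 x1b1] : exists x, x \in b1 by case/setDP: b1d => /ne.
have dis x : x \in cover d -> x \in cover (nu :\: d) -> False.
  move=> /bigcupP[b bd xb] /bigcupP[b' /setDP[b'nu /negP b'd] xb']; apply: b'd.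
  by rewrite -(ti _ _ _ (subsetP dnu _ bd) b'nu xb xb').
have covU x : (x \in cover d) || (x \in cover (nu :\: d)).
  have [|b bnu xb] := cov x; first by rewrite inE.
  have [bd|bd] := boolP (b \in d).
    by apply/orP; left; apply/bigcupP; exists b.
  by apply/orP; right; apply/bigcupP; exists b => //; rewrite inE bd.
have x0d : x0 \in cover d by apply/bigcupP; exists b0.
have x1d : x1 \in cover (nu :\: d) by apply/bigcupP; exists b1.
have cd : cover d != cover (nu :\: d).
  by apply/eqP => e; apply: (dis x0); rewrite // -e.
apply/andP; split; last first.
  apply/forall_inP => b bnu; apply/exists_inP.
  have [bd|bd] := boolP (b \in d).
    by exists (cover d); rewrite ?set21 //; apply: (bigcup_max b).
  exists (cover (nu :\: d)); rewrite ?set22 //.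
  by apply: (bigcup_max b); rewrite // inE bd.
apply/and3P; split; last first.
- apply/forallP => i; apply/exists_inP; have [x <-] := row_surj i.
  have rcl y z : row y = row z -> y \in cover d -> z \in cover d.
    move=> yz /bigcupP[b bd yb]; have [|b' b'nu zb'] := cov z; first by rewrite inE.
    apply/bigcupP; exists b' => //; apply: (cl b) => //.
    by apply/linkedP; exists y, z.
  case/orP: (covU x) => xd.
    exists (cover d); rewrite ?set21 //; apply/subsetP => y; rewrite inE => /eqP yx.
    exact: rcl xd.
  exists (cover (nu :\: d)); rewrite ?set22 //.
  apply/subsetP => y; rewrite inE => /eqP yx.
  case/orP: (covU y) => // yd.
  by case: (dis x) => //; apply: rcl yd.
- by rewrite cards2 cd.
apply/partition_pointwiseP; split.
- by move=> *; rewrite inE.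
- move=> x _; case/orP: (covU x) => xd; first by exists (cover d); rewrite ?set21.
  by exists (cover (nu :\: d)); rewrite ?set22.
- move=> B C x /set2P[] -> /set2P[] -> // xB xC; by case: (dis x).
- by move=> B /set2P[] ->; [exists x0 | exists x1].
Qed.

Hypothesis kappaP : is_kappa kappa.
Let W i : A := \big[star/star1]_(x | row x == i) a x.

Lemma is_kappa1 y : kappa [:: y] = y.
Proof.
have [_ _ kE] := kappaP; have /= := kE 1%N (fun _ => y) isT.
rewrite big_ord1 (big_pred1 [set setT]) => [|nu].
  have -> : [set: 'I_1] = [set ord0] by apply/setP => i; rewrite !inE ord1.
  by rewrite big_set1 enum_set1.
have T0 : [set: 'I_1] != set0 by rewrite -card_gt0 cardsT card_ord.
apply/idP/eqP => [nuT|->]; last exact: partition_set1.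
apply/eqP; rewrite -(partition_card_le1 T0 nuT) (partition_card_le nuT) //.
by rewrite cardsT card_ord.
Qed.

Lemma preimset_row_neq0 (R : {set I}) : R != set0 -> row @^-1: R != set0.
Proof.
by case/set0Pn=> i iR; have [x xi] := row_surj i; apply/set0Pn; exists x; rewrite inE xi.
Qed.

(** [U] is the collapsed value in [sum_kappa_tree_total]; [V] sums its dot-products over the
    connected partitions above the rows [B]. *)
Let U b : A := if single_row row b then kappa [seq a x | x <- enum b] else 0.
Let V (B : {set I}) : A :=
  \sum_(c | partition c (row @^-1: B) && connected_blocks row c)
    \big[dot/dot1]_(b in c) U b.

Lemma dotx0 (x : A) : dot x 0 = 0.
Proof.
by have := dot_linear x (-1) 0 0; rewrite scaler0 addr0 => ->; rewrite scaleN1r addNr.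
Qed.

Lemma big_dot_eq0 (X : finType) (S : {set X}) (f : X -> A) x :
  x \in S -> f x = 0 -> \big[dot/dot1]_(y in S) f y = 0.
Proof. by move=> xS fx; rewrite (bigD1 x) //= fx dotC dotx0. Qed.

(** Over a single row every partition is connected and every block lies in one row, so [V] is the
    cumulant expansion of the star-product. *)
Lemma sum_connected_one_row i : V [set i] = W i.
Proof.
have [ksym _ kE] := kappaP.
have i0 : row @^-1: [set i] != set0.
  by apply: preimset_row_neq0; rewrite -card_gt0 cards1.
have -> : W i = \big[star/star1]_(x in row @^-1: [set i]) a x.
  by apply: eq_bigl => x; rewrite !inE.
rewrite (cumulant_set (op2 := dot) ksym kE a i0).
apply: eq_big => [c|c /andP[cB _]].
  by have [/connected_one_row|] := boolP (partition c _).
apply: eq_bigr => b bc; rewrite /U ifT //.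
have [sub _ _ _] := partition_pointwiseP _ _ cB.
apply/forall_inP => x xb; apply/forall_inP => y yb.
by have := sub _ _ bc xb; have := sub _ _ bc yb; rewrite !inE => /eqP-> /eqP->.
Qed.

(** A connected partition over several rows has a block meeting two of them, on which [U]
    vanishes. *)
Lemma sum_connected_many_rows (B : {set I}) : (1 < #|B|)%N -> V B = 0.
Proof.
move=> B1; apply: big1 => c /andP[cB cc].
have [/forall_inP srow|] := boolP [forall b in c, single_row row b].
  by move: B1; rewrite ltnNge (connected_single_rows cB cc srow).
case/forall_inPn => b bc sb; apply: (big_dot_eq0 bc).
by rewrite /U (negPf sb).
Qed.

Lemma dot_rows (R : {set I}) : R != set0 ->
  \big[dot/dot1]_(i in R) W i =
  \sum_(nu | partition nu (row @^-1: R))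
    \big[star/star1]_(b in nu) tree_total row kappa a b.
Proof.
have [ksym klin kE] := kappaP => R0.
have dlin := bilinear_multilinear (op := dot) (@dot_linear K A).
(* Only the partition of [R] into singletons contributes, and it gives the product of the [W i]. *)
transitivity (\sum_(rho | partition rho R) \big[dot/dot1]_(B in rho) V B).
  rewrite (bigD1 [set [set i] | i in R]) ?partition_singletons //=.
  rewrite [X in _ = _ + X]big1 ?addr0 => [|rho /andP[rhoR nsing]].
    rewrite big_imset => [|i j _ _]; last exact: set1_inj.
    by apply: eq_bigr => i _; rewrite sum_connected_one_row.
  have [/forall_inP B1|] := boolP [forall B in rho, #|B| == 1%N].
    by case/eqP: nsing; apply: partition_in_singletons.
  case/forall_inPn => B Brho B1; apply: (big_dot_eq0 Brho).
  apply: sum_connected_many_rows.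
  by rewrite ltn_neqAle eq_sym B1 card_gt0 (partition_neq0 rhoR).
rewrite (sum_components row_surj dlin).
(* Each [U B] is expanded back into tree sums; regrouping the nested partitions then gives
   star-products through the cumulant formula. *)
transitivity (\sum_(nu | partition nu (row @^-1: R)) \big[dot/dot1]_(B in nu)
    \sum_(pi | partition pi B) kappa [seq tree_total row kappa a b | b <- enum pi]).
  apply: eq_bigr => nu nuR; apply: eq_bigr => B Bnu.
  by rewrite sum_kappa_tree_total // ?(partition_neq0 nuR) //; apply: is_kappa1.
rewrite (sum_nested_partitions dlin); apply: eq_bigr => nu nuR.
rewrite (cumulant_set (op2 := dot) ksym kE) //.
(* The cumulant formula requires at least one factor, so [nu] must be nonempty. *)
apply: contraTneq nuR => ->; apply/negP => /cover_partition.
by rewrite /cover big_set0 => /esym/eqP; apply/negP/preimset_row_neq0.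
Qed.

Variable kappa_star : seq A -> A.
Hypothesis kappa_starP : is_kappa_star kappa_star.

(** Both sides, multiplied over blocks and summed over the partitions of [R], give the dot-product
    of the [W i]. By strong induction on the cardinality of [R] all terms but that of [[set R]]
    agree and cancel. *)
Lemma kappa_star_rows (R : {set I}) : R != set0 ->
  kappa_star [seq W i | i <- enum R] =
  \sum_(c | partition c (row @^-1: R) && connected_blocks row c)
    \big[star/star1]_(b in c) tree_total row kappa a b.
Proof.
have [ksym _ kE] := kappa_starP.
have slin := bilinear_multilinear (op := star) (@star_linear K A).
have [m] := ubnP #|R|; elim: m R => // m IHm R Rm R0.
have := dot_rows R0.
rewrite (cumulant_set (op2 := star) ksym kE W R0) -(sum_components row_surj slin).
rewrite (bigD1 [set R]) ?partition_set1 //= [RHS](bigD1 [set R]) ?partition_set1 //=.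
rewrite !big_set1 => e; apply: (addIr _ (etrans e _)); congr (_ + _).
apply: eq_bigr => rho /andP[rhoR rho1]; apply: eq_bigr => B Brho.
rewrite IHm ?(partition_neq0 rhoR) // (leq_trans (partition_block_card rhoR _ Brho)) //.
by rewrite ltnNge (partition_card_le1 R0 rhoR).
Qed.

End Rows.
End Forests.

Theorem theorem1p13 (K : fieldType) (A : twoMulAlgType K)
    (kappa kappa_star : seq A -> A)
    (kappaP : is_kappa kappa) (kappa_starP : is_kappa_star kappa_star)
    (n : nat) (n_gt0 : (0 < n)%N)
    (k : 'I_n -> nat) (k_gt0 : forall i : 'I_n, (0 < k i)%N)
    (a : forall i : 'I_n, 'I_(k i) -> A) :
  kappa_star [seq \big[star/star1]_(j < k i) a i j | i <- enum 'I_n] =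
  \sum_(F : forest {i : 'I_n & 'I_(k i)} |
          strongly_mixing_reduced_forest
            (fun x : {i : 'I_n & 'I_(k i)} => tag x) F)
    (-1) ^+ weight F *:
      kappa_forest kappa
        (fun x : {i : 'I_n & 'I_(k i)} => a (tag x) (tagged x)) F.
Proof.
have [ksym klin _] := kappaP.
set row := fun x : {i : 'I_n & 'I_(k i)} => tag x.
set a' := fun x : {i : 'I_n & 'I_(k i)} => a (tag x) (tagged x).
(* Positivity of [k i] provides the label with second index 0. *)
have row_surj i : exists x, row x = i.
  by exists (Tagged (fun i => 'I_(k i)) (Ordinal (k_gt0 i))).
have T0 : [set: 'I_n] != set0 by rewrite -card_gt0 cardsT card_ord.
rewrite sum_strongly_mixing_forests //.
have := kappa_star_rows a' row_surj kappaP kappa_starP T0.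
rewrite preimsetT enum_setT -enumT.
under [in RHS]eq_bigl => nu.
  rewrite (_ : _ && _ = partition nu [set: {i : 'I_n & 'I_(k i)}] &&
                        strongly_mixing_partition row nu); last first.
    have [nuT|//] := boolP (partition nu setT).
    by rewrite strongly_mixing_connected.
  over.
move<-; congr kappa_star; apply: eq_map => i.
(* The product over row [i] is written as a double product with outer index restricted to [i], then
   flattened to the pairs with first component [i]. *)
rewrite -(@big_pred1_eq A star1 star _ i (fun i => \big[star/star1]_(j < k i) a i j)).
rewrite (sig_big_dep _ (fun _ => xpredT) a) /=.
by apply: eq_bigl => x; rewrite andbT.
Qed.
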